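(* There is no $2.18$-competitive incremental algorithm for Region Choosing; i.e. there exists an instance of Region Choosing that admits no $2.18$-competitive incremental solution.
   Context: Region Choosing: given $N\in\mathbb N$, pairwise disjoint regions $R_1,\dots,R_N$ with $|R_i|=i$ and densities $\delta(i)\ge0$, ground set $\mathcal U=\bigcup_i R_i$ and objective $f(S)=\max_i|R_i\cap S|\,\delta(i)$ for $S\subseteq\mathcal U$. An incremental solution is an ordering $s_1,\dots,s_{|\mathcal U|}$ of $\mathcal U$; with $\vec S_k=\{s_1,\dots,s_k\}$ and $f^\star_k=\max\{f(S):|S|=k\}$, it is $\rho$-competitive if $f^\star_k/f(\vec S_k)\le\rho$ for all $k\in\{1,\dots,|\mathcal U|\}$. An algorithm is $\rho$-competitive if it outputs a $\rho$-competitive incremental solution on every instance. *)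

(* Defs.v *)
From HB Require Import structures.
From mathcomp Require Import all_boot all_order all_algebra.
From mathcomp Require Import reals.

Set Implicit Arguments.
Unset Strict Implicit.
Unset Printing Implicit Defensive.

Import Order.TTheory GRing.Theory Num.Theory.
Local Open Scope ring_scope.

(* Indices are shifted: [i : 'I_N] stands for the region R_(i+1), which has
   i+1 elements, and for its density delta(i+1). *)
Record region_choosing (R : realType) := RegionChoosing {
  nregions : nat;
  ground : finType;
  region : 'I_nregions -> {set ground};
  density : 'I_nregions -> R;
  region_disjoint : forall i j, i != j -> [disjoint region i & region j];
  region_card : forall i, #|region i| = i.+1;
  region_cover : \bigcup_i region i = [set: ground];
  density_ge0 : forall i, 0 <= density i
}.

(* All the values are nonnegative, so starting the maxima at 0 is harmless. *)
Definition objective (R : realType) (I : region_choosing R)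
    (S : {set ground I}) : R :=
  \big[Num.max/0]_(i < nregions I) (#|region i :&: S|%:R * density i).

Definition opt (R : realType) (I : region_choosing R) (k : nat) : R :=
  \big[Num.max/0]_(S : {set ground I} | #|S| == k) objective S.

Definition incremental_solution (R : realType) (I : region_choosing R)
    (s : seq (ground I)) : Prop :=
  perm_eq s (enum (ground I)).

Definition prefix_set (T : finType) (s : seq T) (k : nat) : {set T} :=
  [set x in take k s].

(* The bound opt / objective <= rho is cleared of its denominator because
   division by 0 yields 0 here: when the prefix has value 0 the ratio must count
   as infinite if the optimum is positive (0 / 0 counts as competitive). *)
Definition competitive_solution (R : realType) (rho : R)
    (I : region_choosing R) (s : seq (ground I)) : Prop :=
  incremental_solution s /\
  forall k : nat, (1 <= k <= #|ground I|)%N ->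
    opt I k <= rho * objective (prefix_set s k).

(* No computability is required of an algorithm. *)
Definition incremental_algorithm (R : realType) : Type :=
  forall I : region_choosing R, {s : seq (ground I) | incremental_solution s}.

Definition competitive_algorithm (R : realType) (rho : R)
    (A : incremental_algorithm R) : Prop :=
  forall I : region_choosing R, competitive_solution rho (sval (A I)).

(* Main.v *)
(** The instance has [M ^ 7] regions, the density of a region being [1 / z] with
    [z] the seventh root of its size, rounded up: the region of size [z ^ 7] has
    value [z ^ 6], so density is (size) ^ (beta - 1) with beta = 6/7.  This beta
    is rational and close to the one giving the best bound, which is 2.1835 for
    beta = 6/7 but only 2.1788 for beta = 8/9.

    Given a competitive ordering, let [t w] be the first time the value reaches
    [w ^ 6], let [b w] be a region reaching it, with root [z w], and let [T w]
    count the elements chosen by time [t w] in regions of index at most [b w].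
    Competitiveness gives [T w <= t w <= rho * w ^ 7] up to rounding, with
    [rho = 2.18 ^ (7/6) < 2.484].  If [p] is the last level before [w] with
    [b p < b w], then [b w <= b p.+1], so
      [T p + p ^ 6 * z w <= rho * p ^ 7]  and  [T w >= T p + w ^ 6 * z w].
    Hence [x * p ^ 7 <= T p] implies [x' * w ^ 7 <= T w] for
    [x' = x / (rho - x) ^ 7 + 1], which exceeds [x] by a fixed amount.
    Iterating, [T w / w ^ 7] exceeds any bound, a contradiction.  Since [T] only
    counts the regions of index at most [b w], no assumption is needed on how
    the ordering interleaves the regions. *)
Require Import Defs.
From HB Require Import structures.
From mathcomp Require Import all_boot all_order all_algebra.
From mathcomp Require Import reals.
From mathcomp Require Import zify ring lra.

Set Implicit Arguments.
Unset Strict Implicit.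
Unset Printing Implicit Defensive.

Import Order.TTheory GRing.Theory Num.Theory.
Local Open Scope ring_scope.

(** * Inequalities for a single growth step *)

(** Cleared of denominators, this is [x + 1/1000 <= x / r ^ 7 + 1] for [r = 2484/1000 - x > 0]: each
    step gains at least [1/1000]. *)
Lemma gain_polynomial (F : realFieldType) (x : F) :
  1 <= x -> x <= 2484 / 1000 ->
  (x - 1 + 1 / 1000) * (2484 / 1000 - x) ^+ 7 <= x.
Proof.
move=> x1 x2; set r := 2484 / 1000 - x.
have -> : x = 2484 / 1000 - r by rewrite /r; ring.
have r0 : 0 <= r by rewrite /r; lra.
have rA : r <= 1484 / 1000 by rewrite /r; lra.
clearbody r; clear x x1 x2.
pose c : F := 529 / 400; pose A : F := 1485 / 1000.
(* [r ^+ 8 - A * r ^+ 7 + 2484 / 1000 - r] is [(r - c) ^+ 2 * Q] plus the linear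
   Taylor remainder at [c], an approximate minimiser. *)
pose Q := r ^+ 6 + (2 * c - A) * r ^+ 5 + c * (3 * c - 2 * A) * r ^+ 4
  + c ^+ 2 * (4 * c - 3 * A) * r ^+ 3 + c ^+ 3 * (5 * c - 4 * A) * r ^+ 2
  + c ^+ 4 * (6 * c - 5 * A) * r + c ^+ 5 * (7 * c - 6 * A).
(* All coefficients of [Q] are nonnegative because [7 * c >= 6 * A]. *)
have Q0 : 0 <= Q.
  by rewrite !addr_ge0 ?mulr_ge0 ?exprn_ge0 // /c /A; lra.
have {}Q0 : 0 <= (r - c) ^+ 2 * Q by rewrite mulr_ge0 ?sqr_ge0.
move: Q0; rewrite /Q /c /A; lra.
Qed.

(** With [r = 2484/1000 - x], the last hypothesis amounts to [z <= r * p]. So [w <= r * p], and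
    [x * p ^ 7] is at least [x * (w / r) ^ 7]. *)
Lemma region_gain (F : realFieldType) (x p w z : F) :
  1 <= x -> 0 < p -> 0 < w -> w <= z ->
  x * p ^+ 7 + p ^+ 6 * z <= 2484 / 1000 * p ^+ 7 ->
  (x + 1 / 1000) * w ^+ 7 <= x * p ^+ 7 + w ^+ 6 * z.
Proof.
move=> x1 p0 w0 wz.
rewrite -lerBrDl -mulrBl (exprSr p 6) mulrCA ler_pM2l ?exprn_gt0 //.
set r := 2484 / 1000 - x => zr; rewrite -exprSr.
have r0 : 0 < r by rewrite -(pmulr_lgt0 _ p0); apply: lt_le_trans zr; lra.
have gain : (x - 1 + 1 / 1000) * r ^+ 7 <= x.
  by apply: gain_polynomial; rewrite // -subr_ge0 ltW.
have wrp : w ^+ 7 <= (r * p) ^+ 7.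
  by apply: lerXn2r; rewrite ?nnegrE ?(le_trans wz zr) ?mulr_ge0 // ltW.
have wz7 : w ^+ 7 <= w ^+ 6 * z by rewrite exprSr ler_pM2l ?exprn_gt0.
have : (x - 1 + 1 / 1000) * w ^+ 7 <= x * p ^+ 7.
  apply: le_trans (_ : (x - 1 + 1 / 1000) * (r * p) ^+ 7 <= _).
    by apply: ler_wpM2l wrp; lra.
  rewrite exprMn mulrA; apply: ler_wpM2r gain; exact/exprn_ge0/ltW.
lra.
Qed.

(* [2.18 ^ (1/6) < 911 / 800 < 2847 / 2500 < 2.484 ^ (1/7)]; the gap absorbs the
   rounding. *)
Lemma rounding (F : realFieldType) (p y : F) :
  300 ^+ 2 <= p -> 0 <= y -> y ^+ 6 < 218 / 100 * (p + 1) ^+ 6 ->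
  (y + 1) ^+ 7 <= 2484 / 1000 * p ^+ 7.
Proof.
move=> p_big y0 ylt.
have {ylt} yp : y < 911 / 800 * (p + 1).
  rewrite -(ltr_pXn2r (n := 6)) ?nnegrE //; last by lra.
  apply: lt_le_trans ylt _; rewrite exprMn; apply: ler_wpM2r; last by lra.
  by apply: exprn_ge0; lra.
apply: le_trans (_ : (2847 / 2500 * p) ^+ 7 <= _).
  by apply: lerXn2r; rewrite ?nnegrE; lra.
rewrite exprMn; apply: ler_wpM2r; last by lra.
by apply: exprn_ge0; lra.
Qed.

Lemma crude_size (y w : nat) :
  (100 * y ^ 6 < 218 * w ^ 6 -> (y + 1) ^ 7 <= 128 * w ^ 7)%N.
Proof.
move=> h; have : (y ^ 6 < (2 * w) ^ 6)%N by rewrite expnMn; lia.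
rewrite ltn_exp2r // addn1 => ylt.
by rewrite -[128%N]/(2 ^ 7)%N -expnMn leq_exp2r.
Qed.

(** Levels start at 1; [p = 0] stands for the absence of a smaller level. *)
Lemma last_smaller_level (b : nat -> nat) (c w : nat) : (0 < w)%N ->
  (c <= b w)%N ->
  exists p, [/\ (p < w)%N, (c <= b p.+1)%N & (0 < p -> b p < c)%N].
Proof.
elim: w => // w IHw _ cw.
case: w IHw cw => [|w] IHw cw; first by exists 0%N.
have [cw'|cw'] := leqP c (b w.+1); last by exists w.+1.
by have [//|p [pw ? ?]] := IHw _ cw'; exists p; split=> //; apply: ltnW.
Qed.

(** * Growth of [T w / w ^ 7] along the levels *)

Section LevelAssignment.

Variables (W : nat) (T b z : nat -> nat).

Hypothesis level_le : forall w, (0 < w <= W -> w <= z w)%N.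
Hypothesis z_mono :
  forall v w, (0 < v <= W -> 0 < w <= W -> b v <= b w -> z v <= z w)%N.
Hypothesis T_ge : forall w, (0 < w <= W -> w ^ 6 * z w <= T w)%N.
Hypothesis T_add :
  forall p w, (0 < p -> p < w <= W -> b p < b w -> T p + w ^ 6 * z w <= T w)%N.
Hypothesis T_lt : forall w, (0 < w <= W)%N ->
  exists2 y, (100 * y ^ 6 < 218 * w ^ 6)%N & (T w <= (y + 1) ^ 7)%N.

(* By [crude_size], the level [p] preceding [w] satisfies [w <= 128 * p.+1], hence
   is beyond the previous threshold. *)
Fixpoint threshold (m : nat) : nat :=
  if m is n.+1 then (128 * (threshold n).+1)%N else (300 ^ 2)%N.

Lemma threshold_ge m : (300 ^ 2 <= threshold m)%N.
Proof. by elim: m => //= m; lia. Qed.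

Lemma T_growth (F : realFieldType) m w : (threshold m <= w <= W)%N ->
  (1 + m%:R / 1000) * w%:R ^+ 7 <= (T w)%:R :> F.
Proof.
elim: m w => [|m IHm] w /andP[mw wW].
  have w0 : (0 < w <= W)%N by rewrite wW andbT; have := threshold_ge 0; lia.
  rewrite mul0r addr0 mul1r -natrX ler_nat.
  apply: leq_trans (T_ge w0); rewrite (expnSr _ 6) leq_mul2l level_le ?orbT //.
have w0 : (0 < w <= W)%N by rewrite wW andbT; have := threshold_ge m.+1; lia.
have [p [pw bp pb]] := last_smaller_level (andP w0).1 (leqnn (b w)).
have p1W : (0 < p.+1 <= W)%N by lia.
have zp := z_mono w0 p1W bp.
have wz := level_le w0.
(* [T_lt] at level [p.+1] bounds [z p.+1], hence also [z w], which is at least [w]. *)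
have zcrude : (z w <= 128 * p.+1)%N.
  have [y /crude_size yp Ty] := T_lt p1W.
  have := leq_trans (T_ge p1W) (leq_trans Ty yp).
  by rewrite (expnSr _ 6) mulnCA leq_pmul2l ?expn_gt0 // => /(leq_trans zp).
have mp : (threshold m <= p)%N by move: mw => /=; lia.
have p0 : (0 < p)%N by have := threshold_ge m; lia.
have {}pb := pb p0.
have Tp : (1 + m%:R / 1000) * p%:R ^+ 7 <= (T p)%:R :> F.
  by apply: IHm; lia.
(* Since [b p < b w <= b p.+1], level [p.+1] adds to [T p] a term with root at least [z w]; this
   caps [z w] in terms of [p]. *)
have Tp1 : (T p + p.+1 ^ 6 * z p.+1 <= T p.+1)%N.
  by apply: T_add; rewrite ?ltnSn ?(leq_trans pb) //; lia.
have [y ylt Ty] := T_lt p1W.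
have Tw : (T p + w ^ 6 * z w <= T w)%N by apply: T_add; rewrite ?pw.
apply: le_trans (_ : (1 + m%:R / 1000) * p%:R ^+ 7 + w%:R ^+ 6 * (z w)%:R <= _).
  rewrite -natr1 (mulrDl m%:R) addrA; apply: region_gain.
  - by rewrite lerDl divr_ge0.
  - by rewrite ltr0n.
  - by rewrite ltr0n; case/andP: w0.
  - by rewrite ler_nat.
  apply: le_trans (_ : (y%:R + 1) ^+ 7 <= _); last first.
    apply: rounding => //.
      by rewrite -natrX ler_nat (leq_trans (threshold_ge m)).
    move: ylt; rewrite -(ltr_nat F) (natrM _ 100) (natrM _ 218) !natrX.
    by rewrite -(natr1 p); lra.
  have : (T p + p ^ 6 * z w <= (y + 1) ^ 7)%N.
    apply: leq_trans (leq_trans Tp1 Ty); rewrite leq_add2l leq_mul //.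
    by rewrite leq_exp2r.
  by rewrite -(ler_nat F) natrD natrM !natrX natrD; lra.
move: Tw; rewrite -(ler_nat F) natrD natrM natrX; lra.
Qed.

End LevelAssignment.

(** * Prefixes, objective and optimum *)

Lemma prefix_set_mono (T : finType) (s : seq T) j k : (j <= k)%N ->
  prefix_set s j \subset prefix_set s k.
Proof.
by move=> jk; apply/subsetP => x; rewrite !inE -(subnKC jk) takeD mem_cat => ->.
Qed.

Lemma card_prefix_set (T : finType) (s : seq T) k : (#|prefix_set s k| <= k)%N.
Proof.
by rewrite cardsE (leq_trans (card_size _)) // size_take_min geq_minl.
Qed.

Lemma prefix_set_full (T : finType) (s : seq T) :
  perm_eq s (enum T) -> prefix_set s #|T| = [set: T].
Proof.
move=> sT; apply/setP => x.
by rewrite !inE cardE -(perm_size sT) take_size (perm_mem sT) mem_enum.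
Qed.

Lemma superset_of_card (T : finType) (A : {set T}) k : (#|A| <= k <= #|T|)%N ->
  exists2 B : {set T}, A \subset B & #|B| = k.
Proof.
case/andP=> Ak kT; pose e := enum A ++ enum (~: A).
have e_size : size e = #|T| by rewrite size_cat -!cardE cardsC.
have e_uniq : uniq e.
  rewrite cat_uniq !enum_uniq andbT; apply/hasPn => x.
  by rewrite !mem_enum inE.
exists (prefix_set e k).
  apply/subsetP => x xA; rewrite inE take_cat -cardE ltnNge Ak /=.
  by rewrite mem_cat mem_enum xA.
by rewrite cardsE (card_uniqP _) ?take_uniq // size_takel // e_size.
Qed.

Section Objective.

Variables (R : realType) (I : region_choosing R).

Lemma objective_ge (S : {set ground I}) i :
  #|region i :&: S|%:R * density i <= objective S.
Proof. exact: le_bigmax. Qed.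

Lemma objective_ge_exists (S : {set ground I}) (c : R) : 0 < c ->
  c <= objective S -> exists i, c <= #|region i :&: S|%:R * density i.
Proof.
move=> c0; rewrite leNgt => /negP cS; apply/existsP.
apply: contraT => /existsPn cN; case: cS; apply/bigmax_ltP; split=> // i _.
by rewrite ltNge cN.
Qed.

Lemma opt_ge k (i : 'I_(nregions I)) : (i.+1 <= k <= #|ground I|)%N ->
  i.+1%:R * density i <= opt I k.
Proof.
rewrite -(region_card i) => /superset_of_card[S iS /eqP Sk].
apply: le_trans (le_bigmax_cond _ _ Sk).
by rewrite -[in X in X <= _](setIidPl iS) objective_ge.
Qed.

End Objective.

(** * Rounded seventh roots and the instance *)

Lemma root7_exists n : exists z, (n <= z ^ 7)%N.
Proof. by exists n; case: n => // n; rewrite expnS leq_pmulr ?expn_gt0. Qed.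

Definition root7 n := ex_minn (root7_exists n).

Lemma root7_ge n : (n <= root7 n ^ 7)%N.
Proof. by rewrite /root7; case: ex_minnP. Qed.

Lemma root7_le n z : (n <= z ^ 7)%N -> (root7 n <= z)%N.
Proof. by rewrite /root7; case: ex_minnP => r _; apply. Qed.

Lemma root7_mono m n : (m <= n)%N -> (root7 m <= root7 n)%N.
Proof. by move=> mn; apply/root7_le/(leq_trans mn)/root7_ge. Qed.

Lemma root7_gt0 n : (0 < root7 n.+1)%N.
Proof. by have := root7_ge n.+1; case: (root7 _). Qed.

Lemma root7_exp z : root7 (z ^ 7) = z.
Proof.
by apply/eqP; rewrite eqn_leq root7_le //= -(leq_exp2r _ _ (e := 7)) ?root7_ge.
Qed.

Section RootInstance.

Variables (R : realType) (M : nat).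

Let N := (M ^ 7)%N.

Definition cell : finType := {i : 'I_N & 'I_i.+1}.

Definition cell_region (i : 'I_N) : {set cell} := [set x | tag x == i].

Lemma card_cell_region i : #|cell_region i| = i.+1.
Proof.
have -> : cell_region i = Tagged (fun j : 'I_N => 'I_j.+1) @: [set: 'I_i.+1].
  apply/setP => x; rewrite inE; apply/eqP/imsetP => [|[y _ ->] //].
  by case: x => j y /= <-; exists y; rewrite ?inE.
rewrite card_imset ?cardsT ?card_ord // => y z /eqP.
by rewrite eq_Tagged => /eqP.
Qed.

Lemma cell_region_disjoint i j :
  i != j -> [disjoint cell_region i & cell_region j].
Proof.
move=> ij; apply/pred0P => x /=; rewrite !inE.
by apply: contraNF ij => /andP[/eqP<- /eqP<-].
Qed.

Lemma cell_region_cover : \bigcup_i cell_region i = [set: cell].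
Proof.
by apply/setP => x; rewrite inE; apply/bigcupP; exists (tag x); rewrite ?inE.
Qed.

Definition root_instance : region_choosing R :=
  @RegionChoosing R N cell cell_region (fun i => (root7 i.+1)%:R^-1)
    cell_region_disjoint card_cell_region cell_region_cover
    (fun i => ltac:(by rewrite invr_ge0 ler0n)).

End RootInstance.

(** * Levels of a competitive ordering *)

Section Competitive.

Variables (R : realType) (W : nat).

Let I := root_instance R (2 * W).

Variable s : seq (ground I).

Hypothesis s_comp : competitive_solution (218%:R / 100%:R) s.

Let count t b := #|[set x in prefix_set s t | tag x == b :> nat]|.

Let value t := objective (prefix_set s t).

Lemma value_ge_exists t c : (0 < c)%N -> c%:R <= value t ->
  exists i : 'I_((2 * W) ^ 7), (c * root7 i.+1 <= count t i)%N.
Proof.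
rewrite -(ltr0n R) => c0 /(objective_ge_exists c0)[i ci]; exists i.
move: ci; rewrite ler_pdivlMr ?ltr0n ?root7_gt0 // -natrM ler_nat => ci.
apply: leq_trans ci _; rewrite /count; apply/eq_leq/eq_card => x.
by rewrite !inE andbC.
Qed.

Lemma pow7_index y : (0 < y <= 2 * W)%N ->
  exists i : 'I_((2 * W) ^ 7), i.+1 = (y ^ 7)%N.
Proof.
move=> /andP[y0 yM]; have y7 : (0 < y ^ 7)%N by rewrite expn_gt0 y0.
have yN : ((y ^ 7).-1 < (2 * W) ^ 7)%N by rewrite prednK // leq_exp2r.
by exists (Ordinal yN); rewrite /= prednK.
Qed.

Lemma region_value y : (0 < y)%N ->
  (y ^ 7)%:R * (root7 (y ^ 7))%:R^-1 = (y ^ 6)%:R :> R.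
Proof.
by move=> y0; rewrite root7_exp (expnSr _ 6) natrM mulfK // pnatr_eq0 -lt0n.
Qed.

(** For [t > 0] take [y = root7 t - 1], so [y ^ 7 < t]. At time [t - 1] the value is still below
    [w ^ 6], while the region of size [y ^ 7] offers [y ^ 6]. *)
Lemma time_bound w t : (0 < w <= W)%N -> (t <= #|ground I|)%N ->
  (forall t', (t' < t)%N -> value t' < (w ^ 6)%:R) ->
  exists2 y, (100 * y ^ 6 < 218 * w ^ 6)%N & (t <= (y + 1) ^ 7)%N.
Proof.
move=> /andP[w0 wW] tn value_lt.
have w6 : (0 < w ^ 6)%N by rewrite expn_gt0 w0.
case: t tn value_lt => [|t] tn value_lt.
  by exists 0%N => //; rewrite muln0 muln_gt0.
exists (root7 t.+1).-1; last by rewrite addn1 prednK ?root7_gt0 ?root7_ge.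
set y := (root7 t.+1).-1.
have y_lt : (y ^ 7 <= t)%N.
  rewrite -ltnS ltnNge; apply/negP => /root7_le.
  by rewrite -[X in (X <= _)%N]prednK ?root7_gt0 // ltnn.
(* A region of size [y ^ 7] exists only up to [y = 2 * W]. The cap is never active, because
   [2 ^ 6 > 2.18]. *)
pose y' := minn y (2 * W).
have y'_bound : (100 * y' ^ 6 < 218 * w ^ 6)%N.
  have [->|y'0] := posnP y'; first by rewrite muln_gt0.
  have y't : (y' ^ 7 <= t)%N.
    by rewrite (leq_trans _ y_lt) // leq_exp2r // geq_minl.
  have [|i iE] := @pow7_index y'; first by rewrite y'0 geq_minr.
  have t0 : (0 < t)%N by rewrite (leq_trans _ y't) // expn_gt0 y'0.
  have := s_comp.2 t; rewrite t0 (ltnW tn) => /(_ isT) opt_le.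
  have opt_y : (y' ^ 6)%:R <= opt I t.
    rewrite -region_value // -iE; apply: (@opt_ge R I t i).
    by rewrite iE y't (ltnW tn).
  have := value_lt _ (ltnSn t); rewrite /value => value_t.
  rewrite -(ltr_nat R) (natrM _ 100) (natrM _ 218).
  lra.
suff -> : y = y' by [].
rewrite /y'; case: (leqP y (2 * W)) => // Wy; move: y'_bound.
have /eqP-> : y' == (2 * W)%N by rewrite /y' (minn_idPr _) // ltnW.
rewrite expnMn => ?; have : (w ^ 6 <= W ^ 6)%N by rewrite leq_exp2r.
lia.
Qed.

(** The range of [w] is assumed under the existential so that choice yields functions on all of
    [nat]. *)
Lemma level_time w : exists tb : nat * nat, (0 < w <= W)%N ->
  [/\ (tb.1 <= #|ground I|)%N, (w ^ 6 * root7 tb.2.+1 <= count tb.1 tb.2)%N,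
      (w ^ 6)%:R <= value tb.1
    & forall t', (t' < tb.1)%N -> value t' < (w ^ 6)%:R].
Proof.
have [w0|] := boolP (0 < w <= W)%N; last by exists (0%N, 0%N).
have w6 : (0 < w ^ 6)%N by rewrite expn_gt0 (andP w0).1.
have full : (w ^ 6)%:R <= value #|ground I|.
  have [|i iE] := @pow7_index (2 * W); first by lia.
  apply: le_trans (objective_ge _ (i : 'I_(nregions I))).
  rewrite (prefix_set_full s_comp.1) setIT region_card iE.
  rewrite -[density _]/((root7 i.+1)%:R^-1) iE region_value; last by lia.
  by rewrite ler_nat leq_exp2r //; lia.
have ex : exists t, (w ^ 6)%:R <= value t by exists #|ground I|.
case: (ex_minnP ex) => t value_t t_min.
have [i ti] := value_ge_exists w6 value_t.
exists (t, val i) => _; split=> //=; first exact: t_min.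
by move=> t' t't; rewrite ltNge; apply/negP => /t_min; rewrite leqNgt t't.
Qed.

Lemma count_le t (b : nat) : (count t b <= b.+1)%N.
Proof.
rewrite /count.
have [bN|bN] := ltnP b ((2 * W) ^ 7); last first.
  rewrite (_ : [set _ in _ | _] = set0) ?cards0 //; apply/setP => x.
  rewrite !inE; apply/negP => /andP[_ /eqP xb].
  by have := ltn_ord (tag x); rewrite xb ltnNge bN.
rewrite -(card_cell_region (Ordinal bN)); apply/subset_leq_card/subsetP => x.
by rewrite !inE => /andP[_]; rewrite -val_eqE.
Qed.

(** Growth gives [T W >= (1 + m / 1000) * W ^ 7 >= 129 * W ^ 7], against the bound [128 * W ^ 7]
    from [crude_size]. *)
Lemma no_large_threshold m : (128 * 1000 <= m)%N -> W = threshold m -> False.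
Proof.
move=> m_big Wm; have [tb tbP] := boolp.choice level_time.
pose t w := (tb w).1; pose b w := (tb w).2.
pose T w := #|[set x in prefix_set s (t w) | (tag x <= b w)%N]|.
pose z w := root7 (b w).+1.
have T_ge w : (0 < w <= W -> w ^ 6 * z w <= T w)%N.
  move=> /tbP[_ /leq_trans tw _ _]; apply: tw.
  apply/subset_leq_card/subsetP => x.
  by rewrite !inE => /andP[-> /eqP->] /=.
have level_le w : (0 < w <= W -> w <= z w)%N.
  (* A region has at most [z w ^ 7] elements, so [w ^ 6 * z w <= z w ^ 7]. *)
  move=> /tbP[_ /leq_trans/(_ (count_le _ _)) tw _ _].
  move: tw => /leq_trans/(_ (root7_ge _)).
  by rewrite (expnSr _ 6) leq_pmul2r ?root7_gt0 // leq_exp2r.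
have z_mono v w : (0 < v <= W -> 0 < w <= W -> b v <= b w -> z v <= z w)%N.
  by move=> _ _ bvw; apply: root7_mono.
have t_mono p w : (0 < p)%N -> (p < w <= W)%N -> (t p <= t w)%N.
  move=> p0 /andP[pw wW].
  have [_ _ _ p_min] : _ := tbP p ltac:(lia).
  have [_ _ w_value _] : _ := tbP w ltac:(lia).
  rewrite leqNgt; apply/negP => /p_min /(le_lt_trans w_value).
  by rewrite ltr_nat ltn_exp2r // ltnNge ltnW.
have T_add p w : (0 < p -> p < w <= W -> b p < b w ->
    T p + w ^ 6 * z w <= T w)%N.
  move=> p0 pwW bpw; have tpw := t_mono p w p0 pwW.
  have [_ tw _ _] : _ := tbP w ltac:(lia).
  (* [T p] counts only indices at most [b p < b w], so it misses region [b w]. *)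
  apply: leq_trans (leq_add (leqnn _) tw) _; rewrite /count -cardsUI.
  rewrite [X in (_ + X)%N](_ : _ = 0%N) ?addn0.
    apply/subset_leq_card/subsetP => x; rewrite !inE => /orP[|] /andP[xs xb].
      have /subsetP/(_ x) := prefix_set_mono s tpw; rewrite !inE => -> //=.
      exact: leq_trans xb (ltnW bpw).
    by rewrite xs (eqP xb) /=.
  apply/eqP; rewrite cards_eq0; apply/eqP/setP => x; rewrite !inE.
  apply/negP => /andP[/andP[_ xp] /andP[_ /eqP xw]].
  by rewrite leqNgt xw bpw in xp.
have T_lt w : (0 < w <= W)%N ->
    exists2 y, (100 * y ^ 6 < 218 * w ^ 6)%N & (T w <= (y + 1) ^ 7)%N.
  move=> w0; have [tn _ _ w_min] := tbP w w0.
  have [y yw ty] := time_bound w0 tn w_min; exists y => //.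
  apply: leq_trans ty; apply: leq_trans (card_prefix_set s _).
  by apply/subset_leq_card/subsetP => x; rewrite inE => /andP[].
have W0 : (0 < W <= W)%N by rewrite leqnn andbT Wm; have := threshold_ge m; lia.
have := @T_growth W T b z level_le z_mono T_ge T_add T_lt R m W.
rewrite Wm leqnn -Wm => /(_ isT) growth.
have [y /crude_size yW Ty] := T_lt W W0.
have := leq_trans Ty yW; rewrite -(ler_nat R) natrM natrX => /(le_trans growth).
rewrite ler_pM2r ?exprn_gt0 ?ltr0n ?(andP W0).1 //.
move: m_big; rewrite -(ler_nat R) natrM; lra.
Qed.

End Competitive.

Theorem theorem14 (R : realType) :
  (~ exists A : incremental_algorithm R,
       competitive_algorithm (218%:R / 100%:R) A) /\
  (exists I : region_choosing R,
     ~ exists s : seq (ground I), competitive_solution (218%:R / 100%:R) s).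
Proof.
(* [m] becomes a variable, so that the huge number [threshold m] is never evaluated. *)
have [m m_big] : exists m, (128 * 1000 <= m)%N by exists (128 * 1000)%N.
pose I := root_instance R (2 * threshold m).
have I_hard :
    ~ exists s : seq (ground I), competitive_solution (218%:R / 100%:R) s.
  by move=> [s s_comp]; exact: (no_large_threshold s_comp m_big erefl).
split; last by exists I.
by move=> [A A_comp]; apply: I_hard; exists (sval (A I)).
Qed.
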